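(* Let $k,d,n$ be positive integers, let $\star\in\{F,\mathcal N\}$, with $n=3$ in the case $\star=\mathcal N$, and consider the function $\mathcal L_\star:M(k,d)\to\mathbb R$, $$\mathcal L_\star(W)=\Big\|\sum_{i=1}^k \mathbf w_i^{\otimes n}-\sum_{i=1}^d \mathbf e_i^{\otimes n}\Big\|_\star^2,$$ where $\mathbf w_1,\dots,\mathbf w_k\in\mathbb R^d$ are the rows of $W$ and $\mathbf e_1,\dots,\mathbf e_d$ is the standard basis of $\mathbb R^d$. Then $\mathcal L_\star$ is $S_k\times S_d$-invariant, i.e. $\mathcal L_\star(P_\pi W P_\rho^\top)=\mathcal L_\star(W)$ for all $W\in M(k,d)$ and all $(\pi,\rho)\in S_k\times S_d$.
   Context: $M(k,d)$ is the space of real $k\times d$ matrices. For a permutation $\pi$ of $\{1,\dots,m\}$, $P_\pi$ is the $m\times m$ permutation matrix with $(P_\pi)_{ij}=1$ if $i=\pi(j)$ and $0$ otherwise. The group $S_k\times S_d$ acts on $M(k,d)$ by $(\pi,\rho)A=P_\pi A P_\rho^\top$, i.e. $((\pi,\rho)A)_{ij}=A_{\pi^{-1}(i),\rho^{-1}(j)}$. A function $f$ on a set $X$ with an action of a group $G$ is $G$-invariant if $f(gx)=f(x)$ for all $x\in X$, $g\in G$. For $\mathbf v\in\mathbb R^d$, $\mathbf v^{\otimes n}$ is the order-$n$ tensor with entries $(\mathbf v^{\otimes n})_{i_1,\dots,i_n}=v_{i_1}\cdots v_{i_n}$. A tensor in $(\mathbb R^d)^{\otimes n}$ is symmetric if its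 entries are invariant under permutation of the indices; the space of these is denoted $S^n(\mathbb R^d)$. The Frobenius inner product is $\langle T,S\rangle_F=\sum_{i_1,\dots,i_n}T_{i_1\dots i_n}S_{i_1\dots i_n}$. The cubic-Gaussian inner product on $S^3(\mathbb R^d)$ is $\langle S,T\rangle_{\mathcal N}=\mathbb E_{\mathbf x\sim\mathcal N(0,I_d)}[\langle S,\mathbf x^{\otimes 3}\rangle_F\langle T,\mathbf x^{\otimes 3}\rangle_F]$. The norm $\|\cdot\|_\star$ is the one induced by $\langle\cdot,\cdot\rangle_\star$ on symmetric tensors. *)

(* Defs.v *)
From HB Require Import structures.
From mathcomp Require Import all_boot all_order all_fingroup all_algebra.
From mathcomp Require Import all_classical all_reals all_analysis.

Set Implicit Arguments.
Unset Strict Implicit.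
Unset Printing Implicit Defensive.

Import Order.TTheory GRing.Theory Num.Theory.
Local Open Scope ring_scope.

Definition G_invariant (gT : finGroupType) (X Y : Type)
    (to : {action gT &-> X}) (f : X -> Y) : Prop :=
  forall (g : gT) (x : X), f (to x g) = f x.

(* This is the transpose of perm_mx pi, see permutation_mxE. *)
Definition permutation_mx (R : realType) (m : nat) (pi : 'S_m) : 'M[R]_m :=
  \matrix_(i, j) (i == pi j)%:R.

Lemma permutation_mxE (R : realType) (m : nat) (pi : 'S_m) :
  permutation_mx R pi = perm_mx pi^-1%g.
Proof.
apply/matrixP => i j; rewrite !mxE; congr (_ %:R).
by rewrite -(inj_eq (@perm_inj _ pi) (pi^-1%g i)) permKV.
Qed.

Definition row_col_perm (R : realType) (k d : nat)
    (A : 'M[R]_(k, d)) (g : 'S_k * 'S_d) : 'M[R]_(k, d) :=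
  permutation_mx R g.1 *m A *m (permutation_mx R g.2)^T.

Lemma row_col_permE (R : realType) (k d : nat) (A : 'M[R]_(k, d))
    (g : 'S_k * 'S_d) (i : 'I_k) (j : 'I_d) :
  row_col_perm A g i j = A ((g.1)^-1%g i) ((g.2)^-1%g j).
Proof.
rewrite /row_col_perm !permutation_mxE tr_perm_mx.
by rewrite -row_permE -col_permE !mxE.
Qed.

(* Permutations compose as (s * t) x = t (s x) in the library, so the usual
   left action is an action in the library's sense, which is on the right. *)
Lemma row_col_perm_is_action (R : realType) (k d : nat) :
  is_action [set: 'S_k * 'S_d] (@row_col_perm R k d).
Proof.
apply: is_total_action => [A|A g h]; apply/matrixP => i j.
  by rewrite row_col_permE !invg1 !perm1.
by rewrite !row_col_permE !invMg !permM.
Qed.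

Canonical row_col_perm_action (R : realType) (k d : nat) :
    {action 'S_k * 'S_d &-> 'M[R]_(k, d)} :=
  Action (@row_col_perm_is_action R k d).

Definition tensor (R : realType) (n d : nat) : Type :=
  {ffun {ffun 'I_n -> 'I_d} -> R}.

Section SymmetricTensors.
Variables (R : realType) (n d : nat).

HB.instance Definition _ := GRing.Lmodule.on (tensor R n d).

Definition symmetric_tensor : {pred tensor R n d} :=
  fun T => [forall s : 'S_n, forall I : {ffun 'I_n -> 'I_d},
      T [ffun a => I (s a)] == T I].

Lemma symmetric_tensorP (T : tensor R n d) :
  reflect (forall (s : 'S_n) (I : {ffun 'I_n -> 'I_d}),
             T [ffun a => I (s a)] = T I)
          (T \in symmetric_tensor).
Proof.
apply: (iffP forallP) => [sT s I|sT s]; first exact/eqP/(forallP (sT s)).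
by apply/forallP => I; rewrite sT.
Qed.

Lemma symmetric_tensor_submod_closed : submod_closed symmetric_tensor.
Proof.
split=> [|a S T /symmetric_tensorP sS /symmetric_tensorP sT].
  by apply/symmetric_tensorP => s I; rewrite !ffunE.
by apply/symmetric_tensorP => s I; rewrite !ffunE sS sT.
Qed.

HB.instance Definition _ :=
  GRing.isSubmodClosed.Build R (tensor R n d) symmetric_tensor
    symmetric_tensor_submod_closed.

Record sym_tensor : Type := SymTensor {
  tensor_of_sym :> tensor R n d;
  _ : tensor_of_sym \in symmetric_tensor }.

HB.instance Definition _ := [isSub of sym_tensor for tensor_of_sym].
HB.instance Definition _ := [Choice of sym_tensor by <:].
HB.instance Definition _ := [SubChoice_isSubLmodule of sym_tensor by <:].
HB.instance Definition _ :=
  GRing.Linear.copy tensor_of_sym (val : sym_tensor -> tensor R n d).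

Definition tensor_power (v : 'rV[R]_d) : tensor R n d :=
  [ffun I : {ffun 'I_n -> 'I_d} => \prod_(a < n) v 0 (I a)].

Lemma tensor_power_symmetric (v : 'rV[R]_d) :
  tensor_power v \in symmetric_tensor.
Proof.
apply/symmetric_tensorP => s I; rewrite !ffunE.
rewrite [RHS](reindex_inj (@perm_inj _ s)) /=.
by apply: eq_bigr => a _; rewrite ffunE.
Qed.

Definition sym_power (v : 'rV[R]_d) : sym_tensor :=
  SymTensor (tensor_power_symmetric v).

Definition frobenius (S T : tensor R n d) : R := \sum_I S I * T I.

End SymmetricTensors.

Section StandardGaussian.
Variable R : realType.

Definition cons_pair (d : nat)
    (p : measurableTypeR R * d.-tuple (measurableTypeR R)) :
  d.+1.-tuple (measurableTypeR R) := [tuple of p.1 :: p.2].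

Lemma measurable_cons_pair (d : nat) :
  measurable_fun [set: _]%classic (@cons_pair d).
Proof. exact: measurable_cons. Qed.

HB.instance Definition _ (d : nat) :=
  isMeasurableFun.Build _ _ _ _ (@cons_pair d) (@measurable_cons_pair d).

(* N(0, I_d) as the d-fold product of the one-dimensional N(0, 1), on
   d-tuples with the product sigma-algebra. *)
Fixpoint std_gaussian (d : nat) :
    probability (d.-tuple (measurableTypeR R)) R :=
  match d with
  | 0 => dirac [tuple]
  | d'.+1 =>
      distribution (normal_prob 0 1 \x std_gaussian d')%E (@cons_pair d')
  end.

Lemma std_gaussian_box (d : nat) (A : 'I_d -> set (measurableTypeR R)) :
  (forall i, measurable (A i)) ->
  (std_gaussian d [set x | forall i, A i (tnth x i)]%classic =
   \prod_(i < d) normal_prob 0 1 (A i))%E.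
Proof.
elim: d A => [|d IH] A mA.
  by rewrite big_ord0 /= diracE mem_set// => -[].
rewrite big_ord_recl /= /distribution /pushforward /=.
rewrite [X in product_measure1 _ _ X](_ : _ =
    A ord0 `*` [set x | forall i, A (lift ord0 i) (tnth x i)])%classic; last first.
  apply/seteqP; split=> -[a x] /=.
    move=> H; split=> [|i]; first exact: (H ord0).
    by have := H (lift ord0 i); rewrite tnthS.
  by move=> [Aa Ax] i; case: (unliftP ord0 i) => [j|] ->; rewrite ?tnthS.
rewrite product_measure1E//.
  by congr (_ * _)%E; exact: (IH (fun i => A (lift ord0 i))).
rewrite [X in measurable X](_ : _ =
    \bigcap_(i in [set: 'I_d])
      ((fun x => tnth x i) @^-1` A (lift ord0 i)))%classic; last first.
  by apply/seteqP; split=> [x H i _|x H i]; [exact: H|exact: (H i)].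
apply: fin_bigcap_measurable => // i _; rewrite -[X in measurable X]setTI.
exact: measurable_tnth.
Qed.

Definition row_of_tuple (d : nat) (x : d.-tuple R) : 'rV[R]_d :=
  \row_i tnth x i.

(* The expectation is finite, its integrand being a polynomial in x. *)
Definition cubic_gaussian (d : nat) (S T : sym_tensor R 3 d) : R :=
  fine (expectation (std_gaussian d) (fun x =>
    frobenius S (sym_power 3 (row_of_tuple x)) *
    frobenius T (sym_power 3 (row_of_tuple x)))).

End StandardGaussian.

Inductive inner_product_kind : nat -> Type :=
| Frobenius (n : nat) : inner_product_kind n
| CubicGaussian : inner_product_kind 3.

Definition sym_inner (R : realType) (n d : nat) (star : inner_product_kind n) :
    sym_tensor R n d -> sym_tensor R n d -> R :=
  match star in inner_product_kind n
        return sym_tensor R n d -> sym_tensor R n d -> R with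
  | Frobenius n => fun S T => frobenius S T
  | CubicGaussian => @cubic_gaussian R d
  end.

Definition sym_norm (R : realType) (n d : nat) (star : inner_product_kind n)
    (T : sym_tensor R n d) : R :=
  Num.sqrt (sym_inner star T T).

Definition loss (R : realType) (k d n : nat) (star : inner_product_kind n)
    (W : 'M[R]_(k, d)) : R :=
  sym_norm star (\sum_(i < k) sym_power n (row i W)
                 - \sum_(i < d) sym_power n (delta_mx 0 i)) ^+ 2.

(* Main.v *)
Require Import Defs.
From HB Require Import structures.
From mathcomp Require Import all_boot all_order all_fingroup all_algebra.
From mathcomp Require Import all_classical all_reals all_analysis.
From mathcomp Require Import measurable_realfun.

Set Implicit Arguments.
Unset Strict Implicit.
Unset Printing Implicit Defensive.

(** Write T(W) for the tensor whose squared norm is the loss at W.  Permuting the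
    rows of W only reorders the first sum of T(W).  Permuting the columns applies
    a coordinate permutation to every w_i; applying it to every e_i as well only
    reorders the second sum.  So T(gW) is the image of T(W) under a relabelling
    of the values of all tensor indices (loss_tensor_permute), and
    it remains to see that this relabelling preserves both inner products
    (sym_inner_permute).

    For the Frobenius product this is a reindexing of a finite sum.  For the
    cubic-Gaussian product, the Frobenius adjoint of the relabelling turns the
    pairing of the relabelled S with the cube of x into the pairing of S with the
    cube of the permuted vector, so the claim reduces to the invariance of
    N(0, I_d) under coordinate permutations.  That holds because permuting a
    box only reorders the factors of its measure, and boxes form a pi-system
    generating the product sigma-algebra (std_gaussian_permute). *)

Import Order.TTheory GRing.Theory Num.Theory.
Local Open Scope ring_scope.

(** * Relabelling the indices of tensors *)

Section PermuteTensor.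
Variables (R : realType) (n d : nat).
Implicit Types (s : 'S_d) (S T : tensor R n d) (v : 'rV[R]_d).

Definition permute_index s (I : {ffun 'I_n -> 'I_d}) : {ffun 'I_n -> 'I_d} :=
  [ffun a => s (I a)].

Lemma permute_indexK s : cancel (permute_index s) (permute_index s^-1%g).
Proof. by move=> I; apply/ffunP => a; rewrite !ffunE permK. Qed.

Definition permute_tensor s T : tensor R n d :=
  [ffun I => T (permute_index s I)].

Lemma permute_tensor_linear s : linear (permute_tensor s).
Proof. by move=> a S T; apply/ffunP => I; rewrite !ffunE. Qed.

HB.instance Definition _ s :=
  GRing.isLinear.Build R (tensor R n d) (tensor R n d) *:%R
    (permute_tensor s) (permute_tensor_linear s).

Lemma permute_tensor_power s v :
  permute_tensor s (tensor_power n v) = tensor_power n (col_perm s v).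
Proof.
apply/ffunP => I; rewrite !ffunE.
by apply: eq_bigr => a _; rewrite ffunE mxE.
Qed.

(** The adjoint form lets the Gaussian case move the permutation from the tensor
    to the sample point. *)
Lemma frobenius_permute_left s S T :
  frobenius (permute_tensor s S) T = frobenius S (permute_tensor s^-1%g T).
Proof.
rewrite /frobenius [RHS](reindex_inj (can_inj (permute_indexK s))).
by apply: eq_bigr => I _; rewrite !ffunE permute_indexK.
Qed.

Lemma frobenius_permute s S T :
  frobenius (permute_tensor s S) (permute_tensor s T) = frobenius S T.
Proof.
rewrite frobenius_permute_left; congr frobenius.
by apply/ffunP => I; rewrite !ffunE -{1}[s]invgK permute_indexK.
Qed.

End PermuteTensor.

(** * Boxes generate the product sigma-algebra *)

Section Boxes.
Variables (R : realType) (d : nat).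
Local Open Scope classical_set_scope.

Definition box (A : 'I_d -> set (measurableTypeR R)) :
    set (d.-tuple (measurableTypeR R)) :=
  [set x | forall i, A i (tnth x i)].

Definition measurable_boxes : set (set (d.-tuple (measurableTypeR R))) :=
  [set box A | A in [set A | forall i, measurable (A i)]].

Lemma boxT : box (fun=> setT) = setT.
Proof. by apply/seteqP; split. Qed.

Lemma boxI A B : box A `&` box B = box (fun i => A i `&` B i).
Proof.
apply/seteqP; split=> [x [Ax Bx] i|x ABx]; first by split.
by split=> i; case: (ABx i).
Qed.

Lemma measurable_box A : (forall i, measurable (A i)) -> measurable (box A).
Proof.
move=> mA; rewrite [X in measurable X](_ : _ =
    \bigcap_(i in [set: 'I_d]) ((fun x => tnth x i) @^-1` A i)); last first.
  by apply/seteqP; split=> [x H i _|x H i]; [exact: H|exact: (H i)].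
apply: fin_bigcap_measurable => // i _; rewrite -[X in measurable X]setTI.
exact: measurable_tnth.
Qed.

(** The generating sets of the product sigma-algebra constrain one coordinate
    only, so each is a box whose other factors are the whole line. *)
Lemma measurable_boxesE : measurable = <<s measurable_boxes >>.
Proof.
apply/seteqP; split; last first.
  apply: smallest_sub; first exact: sigma_algebra_measurable.
  by move=> _ [A mA <-]; exact: measurable_box.
apply: smallest_sub; first exact: smallest_sigma_algebra.
rewrite -bigcup_seq => B [i _ [A mA <-]]; apply: sub_sigma_algebra.
exists (fun j => if j == i then A else setT) => [j /=|].
  by case: ifP.
apply/seteqP; split=> [x /= H|x /= [_ Ax] j]; last by case: eqP => [->|].
by split=> //; have := H i; rewrite eqxx.
Qed.

End Boxes.

(** * Coordinate permutations preserve the standard Gaussian *)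

Section PermuteGaussian.
Variables (R : realType) (d : nat).
Local Notation D := (d.-tuple (measurableTypeR R)).
Local Notation gauss := (std_gaussian R d).

Definition permute_tuple (s : 'S_d) (x : D) : D :=
  [tuple tnth x (s i) | i < d].

Lemma measurable_permute_tuple s :
  measurable_fun [set: D]%classic (permute_tuple s).
Proof.
apply/measurable_fun_tnthP => i.
rewrite (_ : _ \o _ = (fun x : D => tnth x (s i))); first exact: measurable_tnth.
by apply/funext => x /=; rewrite tnth_mktuple.
Qed.

HB.instance Definition _ s :=
  isMeasurableFun.Build _ _ _ _ (permute_tuple s) (measurable_permute_tuple s).

Lemma permute_tuple_box s A :
  (permute_tuple s @^-1` box A = box (fun i => A (s^-1%g i)) :> set D)%classic.
Proof.
apply/seteqP; split=> x /= H i.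
  by have := H (s^-1%g i); rewrite tnth_mktuple permKV.
by have := H (s i); rewrite tnth_mktuple permK.
Qed.

(** Both sides are finite measures that agree on the pi-system of boxes, where the
    two products of one-dimensional measures differ by the order of factors. *)
Lemma std_gaussian_permute s B :
  measurable B -> distribution gauss (permute_tuple s) B = gauss B.
Proof.
apply: (measure_unique (@measurable_boxes R d) (fun=> setT)).
- exact: measurable_boxesE.
- move=> _ _ [A mA <-] [C mC <-]; rewrite boxI.
  by exists (fun i => A i `&` C i)%classic => // i /=; exact: measurableI.
- by move=> _; exists (fun=> setT); rewrite ?boxT//= => i.
- by rewrite bigcup_const//; exists 0%N.
- move=> _ [A mA <-].
  transitivity (gauss (box (fun i => A (s^-1%g i)))).
    by rewrite -permute_tuple_box.
  rewrite std_gaussian_box// [RHS](std_gaussian_box mA).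
  rewrite (reindex_inj (@perm_inj _ s)).
  by apply: eq_bigr => i _; rewrite permK.
- move=> _.
  have le1 := probability_le1 (distribution gauss (permute_tuple s)) measurableT.
  exact: (le_lt_trans le1 (ltry _)).
Qed.

Lemma ge0_integral_gaussian_permute s (f : D -> \bar R) :
  measurable_fun [set: D]%classic f -> (forall x, 0 <= f x)%E ->
  (\int[gauss]_x f (permute_tuple s x) = \int[gauss]_x f x)%E.
Proof.
move=> mf f0.
transitivity (\int[distribution gauss (permute_tuple s)]_x f x)%E.
  apply/esym; rewrite (ge0_integral_pushforward (measurable_permute_tuple s))//.
by apply: eq_measure_integral => B mB _; exact: std_gaussian_permute.
Qed.

(** An expectation is by definition the difference, in the extended reals, of the
    integrals of the positive and negative parts, and each of these two integrals
    is invariant. *)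
Lemma expectation_gaussian_permute s (f : D -> R) :
  measurable_fun [set: D]%classic f ->
  expectation gauss (f \o permute_tuple s) = expectation gauss f.
Proof.
move=> mf; have mEf : measurable_fun [set: D]%classic (EFin \o f).
  exact/measurable_EFinP.
rewrite unlock integralE [RHS]integralE; congr (_ - _)%E.
  rewrite -[RHS](ge0_integral_gaussian_permute s).
  - by apply: eq_integral => x _; rewrite !funeposE.
  - exact: measurable_funepos.
  - by move=> x; exact: funepos_ge0.
rewrite -[RHS](ge0_integral_gaussian_permute s).
- by apply: eq_integral => x _; rewrite !funenegE.
- exact: measurable_funeneg.
- by move=> x; exact: funeneg_ge0.
Qed.

Lemma row_of_permute_tuple s (x : D) :
  row_of_tuple (permute_tuple s x) = col_perm s (row_of_tuple x).
Proof. by apply/rowP => i; rewrite !mxE tnth_mktuple. Qed.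

Lemma measurable_frobenius_power n (T : tensor R n d) :
  measurable_fun [set: D]%classic
    (fun x => frobenius T (tensor_power n (row_of_tuple x))).
Proof.
apply: measurable_sum => I; apply: measurable_funM; first exact: measurable_cst.
rewrite (_ : (fun x : D => _) = (fun x => \prod_(a < n) tnth x (I a))).
  by apply: measurable_prod => a _; exact: measurable_tnth.
by apply/funext => x; rewrite ffunE; apply: eq_bigr => a _; rewrite mxE.
Qed.

Lemma cubic_gaussian_permute s (S T S' T' : sym_tensor R 3 d) :
  S' = permute_tensor s S :> tensor R 3 d ->
  T' = permute_tensor s T :> tensor R 3 d ->
  cubic_gaussian S' T' = cubic_gaussian S T.
Proof.
move=> SE TE; rewrite /cubic_gaussian; congr fine.
(* The inverse appears since the adjoint of permuting by s permutes by s^-1. *)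
rewrite -[RHS](expectation_gaussian_permute s^-1%g).
  congr expectation; apply/funext => x /=; rewrite SE TE row_of_permute_tuple.
  by rewrite -permute_tensor_power !frobenius_permute_left.
by apply: measurable_funM; exact: measurable_frobenius_power.
Qed.

End PermuteGaussian.

(** * Invariance of the loss *)

Lemma sym_inner_permute (R : realType) (n d : nat)
    (star : inner_product_kind n) (s : 'S_d) (S T S' T' : sym_tensor R n d) :
  S' = permute_tensor s S :> tensor R n d ->
  T' = permute_tensor s T :> tensor R n d ->
  sym_inner star S' T' = sym_inner star S T.
Proof.
case: star S T S' T' => [m|] S T S' T' /=; last exact: cubic_gaussian_permute.
by move=> -> ->; exact: frobenius_permute.
Qed.

Lemma row_row_col_perm (R : realType) (k d : nat) (W : 'M[R]_(k, d))
    (g : 'S_k * 'S_d) (i : 'I_k) :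
  row i (row_col_perm W g) = col_perm g.2^-1%g (row (g.1^-1%g i) W).
Proof. by apply/rowP => j; rewrite mxE row_col_permE !mxE. Qed.

Lemma col_perm_delta (R : realType) (d : nat) (s : 'S_d) (i : 'I_d) :
  col_perm s (delta_mx 0 (s i)) = delta_mx 0 i :> 'rV[R]_d.
Proof. by apply/rowP => j; rewrite !mxE (inj_eq perm_inj). Qed.

(** The permutation of rows disappears by reindexing the first sum, and the
    permutation of columns reorders the standard basis in the second. *)
Lemma loss_tensor_permute (R : realType) (k d n : nat) (W : 'M[R]_(k, d))
    (g : 'S_k * 'S_d) :
  (\sum_(i < k) sym_power n (row i (row_col_perm W g))
     - \sum_(i < d) sym_power n (delta_mx 0 i) : sym_tensor R n d) =
  permute_tensor g.2^-1%g
    (\sum_(i < k) sym_power n (row i W)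
       - \sum_(i < d) sym_power n (delta_mx 0 i) : sym_tensor R n d)
  :> tensor R n d.
Proof.
rewrite !raddfB !raddf_sum /=; congr (_ + _).
  rewrite [LHS](reindex_inj (@perm_inj _ g.1)); apply: eq_bigr => i _.
  by rewrite row_row_col_perm permK permute_tensor_power.
rewrite [RHS](reindex_inj (@perm_inj _ g.2^-1%g)); apply: eq_bigr => i _.
by congr (- _); rewrite permute_tensor_power col_perm_delta.
Qed.

Theorem mainTheorem1 (R : realType) (k d n : nat)
    (hk : (0 < k)%N) (hd : (0 < d)%N) (hn : (0 < n)%N)
    (star : inner_product_kind n) :
  G_invariant (row_col_perm_action R k d) (@loss R k d n star).
Proof.
move=> g W; rewrite /loss /sym_norm.
by rewrite (@sym_inner_permute _ _ _ _ g.2^-1%g _ _ _ _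
  (loss_tensor_permute n W g) (loss_tensor_permute n W g)).
Qed.
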